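(* Let $\Gamma\subseteq\Sigma$ be alphabets, $H$ a set of hypotheses over $\Sigma$ and $H'$ a set of hypotheses over $\Gamma$. If $\mathsf{KA}_{H'}$ is complete and decidable, and $H$ reduces to $H'$ via a computable map $r$, then $\mathsf{KA}_H$ is decidable.
   Context: Regular expressions $T(X)$ over an alphabet $X$: $e,f::=e+f\mid e\cdot f\mid e^*\mid 0\mid 1\mid a$ ($a\in X$), with usual language $\llbracket e\rrbracket$. Kleene algebra axioms: idempotent semiring axioms plus $1+xx^*\le x^*$, $x+yz\le z\Rightarrow y^*x\le z$, $x+yz\le y\Rightarrow xz^*\le y$. A hypothesis is a pair of regular expressions $e\le f$. $\mathsf{KA}_H\vdash e=f$ means derivable in equational logic from all instances of the Kleene algebra axioms and the hypotheses in $H$, letters being constants (no substitution rule); $\mathsf{KA}_H$ is decidable if the relation $\{(e,f)\mid\mathsf{KA}_H\vdash e=f\}$ is decidable; $\mathsf{KA}_H\vdash H'$ means all inequations of $H'$ are derivable. The $H$-closure $H^\star(L)$ is the smallest language containing $L$ such that for all $e\le f\in H$ and words $u,v$, $u\llbracket f\rrbracket v\subseteq H^\star(L)$ implies $u\llbracket e\rrbracket v\subseteq H^\star(L)$. $\mathsf{KA}_H$ is complete if $H^\star(\llbracket e\rrbracket)=H^\star(\llbracket f\rrbracket)$ implies $\mathsf{KA}_H\vdash e=f$. $H$ reduces to $H'$ via $r:T(\Sigma)\to T(\Gamma)$ if $\mathsf{KA}_H\vdash H'$ and for all $e\in T(\Sigma)$, $\mathsf{KA}_H\vdash e=r(e)$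 and $H^\star(\llbracket e\rrbracket)\cap\Gamma^*\subseteq H'^\star(\llbracket r(e)\rrbracket)$. *)

(* Defs.v *)
From mathcomp Require Import all_boot.

Set Implicit Arguments.
Unset Strict Implicit.
Unset Printing Implicit Defensive.

Declare Scope regex_scope.
Delimit Scope regex_scope with RE.

Inductive regex (X : Type) : Type :=
| Zero | One
| Letter of X
| Plus of regex X & regex X
| Dot of regex X & regex X
| Star of regex X.

Arguments Zero {X}.
Arguments One {X}.

Bind Scope regex_scope with regex.
Notation "0" := Zero : regex_scope.
Notation "1" := One : regex_scope.
Notation "e + f" := (Plus e f) : regex_scope.
Notation "e * f" := (Dot e f) : regex_scope.
Notation "e ^*" := (Star e) : regex_scope.

Fixpoint re_map (X Y : Type) (h : X -> Y) (e : regex X) : regex Y :=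
  match e with
  | Zero => Zero
  | One => One
  | Letter a => Letter (h a)
  | Plus e f => Plus (re_map h e) (re_map h f)
  | Dot e f => Dot (re_map h e) (re_map h f)
  | Star e => Star (re_map h e)
  end.

Definition language (X : Type) := seq X -> Prop.

Inductive lang_star (X : Type) (L : language X) : language X :=
| lang_star_nil : lang_star L [::]
| lang_star_cat u v : L u -> lang_star L v -> lang_star L (u ++ v).

Fixpoint lang (X : Type) (e : regex X) : language X :=
  match e with
  | Zero => fun=> False
  | One => fun w => w = [::]
  | Letter a => fun w => w = [:: a]
  | Plus e f => fun w => lang e w \/ lang f w
  | Dot e f => fun w => exists u v, [/\ w = u ++ v, lang e u & lang f v]
  | Star e => lang_star (lang e)
  end.

(* [H e f] means that the inequation e <= f belongs to the set H, which may be
   infinite. *)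
Definition hypotheses (X : Type) := regex X -> regex X -> Prop.

Reserved Notation "H |-- e === f" (at level 70, e, f at level 60).
Reserved Notation "H |-- e <== f" (at level 70, e, f at level 60).

(* Letters are constants: there is no substitution rule. The Horn axioms of
   Kleene algebra are inference rules on derivable inequations. *)
Inductive ka_eq (X : Type) (H : hypotheses X) : regex X -> regex X -> Prop :=
| ka_refl e : H |-- e === e
| ka_sym e f : H |-- e === f -> H |-- f === e
| ka_trans e f g : H |-- e === f -> H |-- f === g -> H |-- e === g
| ka_cong_plus e e' f f' :
    H |-- e === e' -> H |-- f === f' -> H |-- e + f === e' + f'
| ka_cong_dot e e' f f' :
    H |-- e === e' -> H |-- f === f' -> H |-- e * f === e' * f'
| ka_cong_star e e' : H |-- e === e' -> H |-- e^* === e'^*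
| ka_plusA e f g : H |-- e + (f + g) === e + f + g
| ka_plusC e f : H |-- e + f === f + e
| ka_plus0 e : H |-- e + 0 === e
| ka_plusI e : H |-- e + e === e
| ka_dotA e f g : H |-- e * (f * g) === e * f * g
| ka_dot1 e : H |-- e * 1 === e
| ka_1dot e : H |-- 1 * e === e
| ka_dot0 e : H |-- e * 0 === 0
| ka_0dot e : H |-- 0 * e === 0
| ka_dotDr e f g : H |-- e * (f + g) === e * f + e * g
| ka_dotDl e f g : H |-- (e + f) * g === e * g + f * g
| ka_star_unfold e : H |-- 1 + e * e^* <== e^*
| ka_star_indl e f g : H |-- e + f * g <== g -> H |-- f^* * e <== g
| ka_star_indr e f g : H |-- e + f * g <== f -> H |-- e * g^* <== f
| ka_hyp e f : H e f -> H |-- e <== f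
where "H |-- e === f" := (ka_eq H e%RE f%RE)
  and "H |-- e <== f" := (ka_eq H (Plus e%RE f%RE) f%RE).

(* Being inductive, this is the smallest language containing L that satisfies
   the closure condition. *)
Inductive hyp_closure (X : Type) (H : hypotheses X) (L : language X) : language X :=
| hyp_closure_base w : L w -> hyp_closure H L w
| hyp_closure_step e f u v : H e f ->
    (forall w, lang f w -> hyp_closure H L (u ++ w ++ v)) ->
    forall w, lang e w -> hyp_closure H L (u ++ w ++ v).

Definition ka_complete (X : Type) (H : hypotheses X) : Prop :=
  forall e f : regex X,
    (forall w, hyp_closure H (lang e) w <-> hyp_closure H (lang f) w) ->
    H |-- e === f.

(* Computability is expressed with the partial recursive functions: asking only
   for a Rocq function into [bool] would make every relation decidable in the
   presence of classical logic and choice. *)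
Inductive recfun : nat -> Type :=
| RZero : recfun 0
| RSucc : recfun 1
| RProj n (i : 'I_n) : recfun n
| RComp m n (p : recfun m) (q : 'I_m -> recfun n) : recfun n
| RPrec n (p : recfun n) (q : recfun n.+2) : recfun n.+1
| RMin n (p : recfun n.+1) : recfun n.

(* [computes p v y]: the partial function denoted by p is defined at v, with
   value y. For primitive recursion, s is the sequence of intermediate values,
   the recursion being on the first argument. *)
Fixpoint computes n (p : recfun n) : n.-tuple nat -> nat -> Prop :=
  match p in recfun n return n.-tuple nat -> nat -> Prop with
  | RZero => fun _ y => y = 0
  | RSucc => fun v y => y = (thead v).+1
  | RProj n i => fun v y => y = tnth v i
  | RComp m n p q => fun v y =>
      exists2 w : m.-tuple nat,
        forall i, computes (q i) v (tnth w i) & computes p w y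
  | RPrec n p q => fun v y =>
      exists s : nat -> nat,
        [/\ computes p [tuple of behead v] (s 0),
            forall k, k < thead v ->
              computes q [tuple of k :: s k :: behead v] (s k.+1)
          & y = s (thead v)]
  | RMin n p => fun v y =>
      computes p [tuple of y :: v] 0 /\
      forall k, k < y -> exists z, computes p [tuple of k :: v] z.+1
  end.

(* Goedel numbering of regular expressions; [CodeSeq.code] is an effective
   bijection between lists of numbers and numbers, and [pickle] is the numbering
   of the alphabet. When the alphabet is finite, all numberings of it give the
   same notions of computability below. *)
Fixpoint re_code (X : countType) (e : regex X) : nat :=
  match e with
  | Zero => CodeSeq.code [:: 0]
  | One => CodeSeq.code [:: 1]
  | Letter a => CodeSeq.code [:: 2; pickle a]
  | Plus e f => CodeSeq.code [:: 3; re_code e; re_code f]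
  | Dot e f => CodeSeq.code [:: 4; re_code e; re_code f]
  | Star e => CodeSeq.code [:: 5; re_code e]
  end.

Definition re_computable (X Y : countType) (r : regex X -> regex Y) : Prop :=
  exists p : recfun 1, forall e, computes p [tuple re_code e] (re_code (r e)).

Definition re_decidable (X : countType) (R : regex X -> regex X -> Prop) : Prop :=
  exists p : recfun 2, forall e f,
    exists2 b : bool,
      computes p [tuple re_code e; re_code f] (nat_of_bool b) & b <-> R e f.

Definition ka_decidable (X : countType) (H : hypotheses X) : Prop :=
  re_decidable (fun e f => H |-- e === f).

(* The alphabet of the elements of a subset Gamma of Sigma; the inclusions of
   words and expressions over it are [map val] and [re_map val]. *)
Definition sub_alphabet (Sigma : countType) (Gamma : {pred Sigma}) : countType :=
  {a : Sigma | a \in Gamma}.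

Definition reduces_via (Sigma : countType) (Gamma : {pred Sigma})
    (H : hypotheses Sigma) (H' : hypotheses (sub_alphabet Gamma))
    (r : regex Sigma -> regex (sub_alphabet Gamma)) : Prop :=
  (forall e f, H' e f -> H |-- re_map val e <== re_map val f) /\
  (forall e : regex Sigma,
      H |-- e === re_map val (r e) /\
      (forall w : seq (sub_alphabet Gamma),
          hyp_closure H (lang e) (map val w) -> hyp_closure H' (lang (r e)) w)).

(* Main.v *)
Require Import Defs.
From mathcomp Require Import all_boot.

(** The equivalence [H |-- e === f <-> H' |-- r e === r f] turns a decision
    procedure for [H'] into one for [H]. From right to left it only uses that
    [H] derives [H'] and [e === r e]. From left to right, completeness of [H']
    leaves us to compare the [H']-closures of [r e] and [r f]: a word in the
    former lies in the [H]-closure of [r e], hence of [e] and of [f] by soundness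
    of [H]; being a word over Gamma, it then lies in the [H']-closure of [r f]. *)

Set Implicit Arguments.
Unset Strict Implicit.
Unset Printing Implicit Defensive.

(** * Soundness of derivability with respect to closures *)

Section Closure.
Variables (X : Type) (H : hypotheses X).
Implicit Types (L M : language X) (e f g : regex X) (u v w : seq X).

(** A closure step may be taken in any context, so [u] and [v] are absorbed into the context of each
    step. Keeping [L] and [M] distinct makes idempotence of the closure and its compatibility with
    concatenation special cases. *)
Lemma hyp_closure_context L M u v :
  (forall w, L w -> hyp_closure H M (u ++ w ++ v)) ->
  forall w, hyp_closure H L w -> hyp_closure H M (u ++ w ++ v).
Proof.
move=> LM w; elim=> {w} [w /LM //|e f u' v' Hef _ IH w ew].
rewrite -!catA catA; apply: hyp_closure_step Hef _ _ ew => w' fw'.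
by have := IH _ fw'; rewrite -!catA.
Qed.

Lemma hyp_closure_bind L M :
  (forall w, L w -> hyp_closure H M w) ->
  forall w, hyp_closure H L w -> hyp_closure H M w.
Proof.
move=> LM w Lw; have := @hyp_closure_context L M [::] [::] _ w Lw.
by rewrite /= cats0; apply=> w' /LM; rewrite cats0.
Qed.

Lemma hyp_closure_catl L M u :
  (forall w, L w -> hyp_closure H M (u ++ w)) ->
  forall w, hyp_closure H L w -> hyp_closure H M (u ++ w).
Proof.
move=> LM w Lw; have := @hyp_closure_context L M u [::] _ w Lw.
by rewrite cats0; apply=> w' /LM; rewrite cats0.
Qed.

Lemma hyp_closure_catr L M v :
  (forall w, L w -> hyp_closure H M (w ++ v)) ->
  forall w, hyp_closure H L w -> hyp_closure H M (w ++ v).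
Proof. exact: (@hyp_closure_context L M [::] v). Qed.

Lemma hyp_closure_dot e f u v :
  hyp_closure H (lang e) u -> hyp_closure H (lang f) v ->
  hyp_closure H (lang (e * f)%RE) (u ++ v).
Proof.
move=> eu fv; apply: (hyp_closure_catr _ eu) => {eu}u eu.
apply: (hyp_closure_catl _ fv) => {fv}v fv.
by apply: hyp_closure_base; exists u, v.
Qed.

Lemma lang_star_closure e f :
  (forall w, lang e w -> hyp_closure H (lang f) w) ->
  forall w, lang (e^*)%RE w -> hyp_closure H (lang (f^*)%RE) w.
Proof.
move=> ef w; elim=> {w} [|u v eu _ fv].
  by apply: hyp_closure_base; apply: lang_star_nil.
(* Peel off one factor as a product, then fold [f * f^*] back into [f^*]. *)
apply: (@hyp_closure_bind (lang (f * f^*)%RE)); last first.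
  exact: hyp_closure_dot (ef _ eu) fv.
by move=> _ [u' [v' [-> fu' fv']]]; apply/hyp_closure_base/lang_star_cat.
Qed.

(** Induction on the factors from [f^*]: each is prepended to a word already in the closure of [g],
    and the premise applies underneath that closure. *)
Lemma ka_star_indl_sound e f g :
  (forall w, lang (e + f * g)%RE w -> hyp_closure H (lang g) w) ->
  forall w, lang (f^* * e)%RE w -> hyp_closure H (lang g) w.
Proof.
move=> le_g _ [u [v [-> fu ev]]]; elim: fu => [|u1 u2 fu1 _ IH].
  by apply: le_g; left.
rewrite -catA; apply: (hyp_closure_catl _ IH) => w gw.
by apply: le_g; right; exists u1, w.
Qed.

(* [lang_star] unfolds from the left, hence the accumulator [u]. *)
Lemma ka_star_indr_sound e f g :
  (forall w, lang (e + f * g)%RE w -> hyp_closure H (lang f) w) ->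
  forall w, lang (e * g^*)%RE w -> hyp_closure H (lang f) w.
Proof.
move=> le_f _ [u [v [-> eu gv]]].
have {eu}: hyp_closure H (lang f) u by apply: le_f; left.
elim: gv u => [|v1 v2 gv1 _ IH] u fu; first by rewrite cats0.
rewrite catA; apply: IH; apply: (hyp_closure_catr _ fu) => w fw.
by apply: le_f; right; exists w, v1.
Qed.

(** Induction on the derivation. Having plain languages on the left keeps each rule elementary;
    [hyp_closure_bind] extends the inclusions to closures. *)
Lemma ka_sound_incl e f : H |-- e === f ->
  (forall w, lang e w -> hyp_closure H (lang f) w) /\
  (forall w, lang f w -> hyp_closure H (lang e) w).
Proof.
have B L w : L w -> hyp_closure H L w by exact: hyp_closure_base.
(* For the axioms that already hold as equalities of languages. *)
have K L M : (forall w, L w <-> M w) ->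
    (forall w, L w -> hyp_closure H M w) /\ (forall w, M w -> hyp_closure H L w).
  by move=> LM; split=> w /LM /B.
have D (e1 e2 f1 f2 : regex X) :
    (forall w, lang e1 w -> hyp_closure H (lang e2) w) ->
    (forall w, lang f1 w -> hyp_closure H (lang f2) w) ->
    forall w, lang (e1 * f1)%RE w -> hyp_closure H (lang (e2 * f2)%RE) w.
  by move=> e12 f12 _ [u [v [-> /e12 eu /f12 fv]]]; apply: hyp_closure_dot.
have P (e1 e2 f1 f2 : regex X) :
    (forall w, lang e1 w -> hyp_closure H (lang e2) w) ->
    (forall w, lang f1 w -> hyp_closure H (lang f2) w) ->
    forall w, lang (e1 + f1)%RE w -> hyp_closure H (lang (e2 + f2)%RE) w.
  move=> e12 f12 w [/e12|/f12]; apply: hyp_closure_bind => {}w ?; apply: B.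
    by left.
  by right.
(* For inequations, which are encoded as [e1 + f1 === f1]: only the inclusion of [e1] has
   content. *)
have I e1 f1 : (forall w, lang e1 w -> hyp_closure H (lang f1) w) ->
    (forall w, lang (e1 + f1)%RE w -> hyp_closure H (lang f1) w) /\
    (forall w, lang f1 w -> hyp_closure H (lang (e1 + f1)%RE) w).
  by move=> ef; split=> w => [[/ef|/B] | fw] //; apply: B; right.
elim=> {e f}.
- by move=> e; apply: K.
- by move=> e f _ [].
- by move=> e f g _ [ef fe] _ [fg gf]; split=> w => [/ef|/gf];
    apply: hyp_closure_bind.
- by move=> e e' f f' _ [? ?] _ [? ?]; split; apply: P.
- by move=> e e' f f' _ [? ?] _ [? ?]; split; apply: D.
- by move=> e e' _ [? ?]; split; apply: lang_star_closure.
- by move=> e f g; apply: K => w /=; tauto.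
- by move=> e f; apply: K => w /=; tauto.
- by move=> e; apply: K => w /=; tauto.
- by move=> e; apply: K => w /=; tauto.
- move=> e f g; apply: K => w /=; split.
    move=> [u [_ [-> eu [v [x [-> fv gx]]]]]]; exists (u ++ v), x.
    by rewrite catA; split=> //; exists u, v.
  move=> [_ [x [-> [u [v [-> eu fv]]] gx]]]; exists u, (v ++ x).
  by rewrite catA; split=> //; exists v, x.
- move=> e; apply: K => w /=; split=> [[u [v [-> eu ->]]]|ew].
    by rewrite cats0.
  by exists w, [::]; rewrite cats0.
- move=> e; apply: K => w /=; split=> [[u [v [-> -> ev]]]|ew] //.
  by exists [::], w.
- by move=> e; apply: K => w /=; split=> [[u [v []]]|].
- by move=> e; apply: K => w /=; split=> [[u [v []]]|].
- move=> e f g; apply: K => w /=; split.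
    by move=> [u [v [-> eu [fv|gv]]]]; [left|right]; exists u, v.
  by move=> [] [u [v [-> eu fv]]]; exists u, v; split=> //; [left|right].
- move=> e f g; apply: K => w /=; split.
    by move=> [u [v [-> [eu|fu] gv]]]; [left|right]; exists u, v.
  by move=> [] [u [v [-> eu fv]]]; exists u, v; split=> //; [left|right].
- move=> e; apply: I => w /= [->|[u [v [-> eu ev]]]]; apply: B.
    exact: lang_star_nil.
  exact: lang_star_cat.
- by move=> e f g _ [le_g _]; apply/I/ka_star_indl_sound => w ?;
    apply: le_g; left.
- by move=> e f g _ [le_f _]; apply/I/ka_star_indr_sound => w ?;
    apply: le_f; left.
(* A hypothesis is a single closure step in the empty context. *)
- move=> e f Hef; apply: I => w ew; rewrite -[w]cats0.
  by apply: (@hyp_closure_step _ _ _ e f [::] [::]) => // w' /B; rewrite cats0.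
Qed.

Lemma ka_sound e f : H |-- e === f ->
  forall w, hyp_closure H (lang e) w -> hyp_closure H (lang f) w.
Proof. by case/ka_sound_incl=> ef _; apply: hyp_closure_bind. Qed.

End Closure.

(** * Transport along a map of alphabets *)

Section Map.
Variables (X Y : Type) (h : X -> Y).

Lemma lang_re_map (e : regex X) w :
  lang e w -> lang (re_map h e) (map h w).
Proof.
elim: e w => [||a|e IHe f IHf|e IHe f IHf|e IHe] w //=.
- by move=> ->.
- by move=> ->.
- by move=> [/IHe|/IHf]; [left|right].
- move=> [u [v [-> /IHe eu /IHf fv]]]; exists (map h u), (map h v).
  by rewrite map_cat.
- elim=> {w} [|u v /IHe eu _ IH]; first exact: lang_star_nil.
  by rewrite map_cat; apply: lang_star_cat.
Qed.

Lemma lang_re_map_inv (e : regex X) w :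
  lang (re_map h e) w -> exists2 w', lang e w' & w = map h w'.
Proof.
elim: e w => [||a|e IHe f IHf|e IHe f IHf|e IHe] w //=.
- by move=> ->; exists [::].
- by move=> ->; exists [:: a].
- by move=> [/IHe|/IHf] [w' ? ->]; exists w' => //; [left|right].
- move=> [_ [_ [-> /IHe[u eu ->] /IHf[v fv ->]]]]; exists (u ++ v).
    by exists u, v.
  by rewrite map_cat.
- elim=> {w} [|_ _ /IHe[u eu ->] _ [v ev ->]].
    by exists [::] => //; apply: lang_star_nil.
  by exists (u ++ v); [apply: lang_star_cat|rewrite map_cat].
Qed.

Variables (H : hypotheses Y) (H' : hypotheses X).
Hypothesis HH' :
  forall e f, H' e f -> H |-- re_map h e <== re_map h f.

Lemma ka_eq_re_map e f :
  H' |-- e === f -> H |-- re_map h e === re_map h f.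
Proof.
elim=> {e f} /=; try by move=> *; constructor.
- by move=> e f g _ ef _; apply: ka_trans.
- by move=> e f /HH'.
Qed.

(** A step of [H'] need not be a step of [H], where its inequation is only derivable; soundness of
    [H] turns that inequation into an inclusion, used inside the context of the step. *)
Lemma hyp_closure_re_map e w :
  hyp_closure H' (lang e) w -> hyp_closure H (lang (re_map h e)) (map h w).
Proof.
elim=> {w} [w /lang_re_map|e' f u v /HH' le_ef _ IH w ew].
  exact: hyp_closure_base.
rewrite !map_cat; apply: (@hyp_closure_context _ _ (lang (re_map h f))).
  (* The induction hypothesis only speaks of images of words over [X], hence the preimage [w']. *)
  by move=> _ /lang_re_map_inv[w' fw' ->]; rewrite -!map_cat; apply: IH.
by apply: (ka_sound_incl le_ef).1; left; apply: lang_re_map.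
Qed.

End Map.

(** * Transfer of derivability and decidability *)

Lemma reduces_via_ka_eq (Sigma : countType) (Gamma : {pred Sigma})
    (H : hypotheses Sigma) (H' : hypotheses (sub_alphabet Gamma))
    (r : regex Sigma -> regex (sub_alphabet Gamma)) e f :
  ka_complete H' -> reduces_via H H' r ->
  H' |-- r e === r f <-> H |-- e === f.
Proof.
move=> complete [HH' red]; split=> [ref|ef].
  apply: ka_trans (red e).1 (ka_trans _ (ka_sym (red f).1)).
  exact: ka_eq_re_map ref.
(* Stated for arbitrary expressions, so that symmetry yields the converse inclusion. *)
have incl e1 f1 : H |-- e1 === f1 -> forall w,
    hyp_closure H' (lang (r e1)) w -> hyp_closure H' (lang (r f1)) w.
  move=> ef1 w /(hyp_closure_re_map HH') e1w; apply: (red f1).2.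
  exact: ka_sound (ka_trans (ka_sym (red e1).1) ef1) _ e1w.
by apply: complete => w; split; apply: incl => //; apply: ka_sym.
Qed.

Lemma re_decidable_preim (X Y : countType) (r : regex X -> regex Y)
    (R : regex X -> regex X -> Prop) (R' : regex Y -> regex Y -> Prop) :
  (forall e f, R' (r e) (r f) <-> R e f) ->
  re_computable r -> re_decidable R' -> re_decidable R.
Proof.
move=> RR' [q qP] [p pP].
(* The unary [q] translates the [i]-th argument, selected by [RProj i]; then [p] decides on the two
   resulting codes. *)
exists (RComp p (fun i : 'I_2 => RComp q (fun=> RProj i))) => e f.
have [b pb bR'] := pP (r e) (r f); exists b; last first.
  exact: iff_trans bR' (RR' e f).
exists [tuple re_code (r e); re_code (r f)] => // i.
(* The input of [q] is a one-entry tuple, whose only index is [ord0]. *)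
exists [tuple tnth [tuple re_code e; re_code f] i] => [j|].
  by rewrite (ord1 j).
by case: i => [[|[|i]] i_lt2] //; exact: qP.
Qed.

Theorem theorem2p12 (Sigma : countType) (Gamma : {pred Sigma})
    (H : hypotheses Sigma) (H' : hypotheses (sub_alphabet Gamma))
    (r : regex Sigma -> regex (sub_alphabet Gamma)) :
  ka_complete H' -> ka_decidable H' ->
  reduces_via H H' r -> re_computable r ->
  ka_decidable H.
Proof.
move=> complete dec red comp; apply: re_decidable_preim comp dec => e f.
exact: reduces_via_ka_eq.
Qed.
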